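(* There exists a universal constant $C>0$ such that the following holds. Let $d$ be an even positive integer, let $K,L,a,\delta$ be positive integers with $\delta\le \frac d4$, $d=aL$ and $1\le a<\delta$, let $\mathbf{m}_1,\dots,\mathbf{m}_K\in\mathbb{C}^d$ be vectors all of whose nonzero entries have indices in $\{1,\dots,\delta\}$, and let $0<p\le q$. Let $Y$ be the measurement map with coordinates $Y_{k,\ell}(\mathbf{x})=|\langle S_{\ell a}\mathbf{m}_k,\mathbf{x}\rangle|^2$, $1\le k\le K$, $1\le \ell\le L$, restricted to $\mathcal{C}_{p,q}\subset\mathbb{C}^d/\!\sim$. If $A$ is any map into $\mathbb{C}^d/\!\sim$, defined on a subset of $\mathbb{R}^{K\times L}$ containing $Y(\mathcal{C}_{p,q})$, which is Lipschitz with respect to the Euclidean norm on $\mathbb{R}^{K\times L}$ and the metric $d_1$ on $\mathbb{C}^d/\!\sim$, with Lipschitz constant $C_A$, and which satisfies $A(Y(\mathbf{x}))=\mathbf{x}$ for all $\mathbf{x}\in\mathcal{C}_{p,q}$, then $$C_A\;\ge\; C\,\frac{qd\sqrt{a}}{p\sqrt{K}\,\|\mathbf{m}\|_\infty^2\,\delta^{5/2}}\;=\;C\,\frac{qd^{3/2}}{p\sqrt{KL}\,\|\mathbf{m}\|_\infty^2\,\delta^{5/2}},$$ where $\|\mathbf{m}\|_\infty:=\max_{1\le k\le K}\|\mathbf{m}_k\|_\infty$.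
   Context: Entries of $\mathbf{x}\in\mathbb{C}^d$ are written $\mathbf{x}(1),\dots,\mathbf{x}(d)$, and $\langle\mathbf{u},\mathbf{v}\rangle=\sum_{n=1}^d\mathbf{u}(n)\overline{\mathbf{v}(n)}$. The equivalence relation $\sim$ on $\mathbb{C}^d$ is: $\mathbf{x}\sim\mathbf{x}'$ iff $\mathbf{x}=e^{i\theta}\mathbf{x}'$ for some $\theta\in\mathbb{R}$. The metric $d_1$ on $\mathbb{C}^d/\!\sim$ is $d_1(\mathbf{x},\mathbf{x}')=\|\mathbf{x}\mathbf{x}^*-\mathbf{x}'\mathbf{x}'^*\|_1=\sum_k\sigma_k(\mathbf{x}\mathbf{x}^*-\mathbf{x}'\mathbf{x}'^* )$, where $\sigma_k(\cdot)$ is the $k$-th singular value (so $\|\cdot\|_1$ is the nuclear norm). For $\ell\in\mathbb{Z}$, the circular shift $S_\ell$ on $\mathbb{C}^d$ is $(S_\ell\mathbf{x})(n)=\mathbf{x}\big(((n+\ell-1)\bmod d)+1\big)$. The map $Y$ is well defined on $\mathbb{C}^d/\!\sim$. For $0<p\le q$, $\mathcal{C}_{p,q}=\{\mathbf{x}\in\mathbb{C}^d/\!\sim\;:\; p\le|\mathbf{x}(n)|\le q \text{ for all }1\le n\le d\}$. The Lipschitz constant of a map is its smallest valid Lipschitz constant. ''Universal'' means independent of all of $d,K,L,a,\delta,p,q$, the masks $\mathbf{m}_k$, and $A$. *)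

(* Defs.v *)
(* Indices are 0-based throughout: the ordinal n stands for the mathematical
   index n + 1. *)
From HB Require Import structures.
From mathcomp Require Export all_boot all_order all_algebra.
From mathcomp Require Export spectral.
From mathcomp Require Export generic_quotient.
From mathcomp Require Export complex.
From mathcomp Require Export all_classical all_reals all_analysis.

Set Implicit Arguments.
Unset Strict Implicit.
Unset Printing Implicit Defensive.

Import Order.TTheory GRing.Theory Num.Theory.
Import ComplexField.Normc.

Local Open Scope ring_scope.
Local Open Scope complex_scope.
Local Open Scope classical_set_scope.
Local Open Scope quotient_scope.
Local Open Scope sesquilinear_scope.

Section Phase.
Context {R : realType}.

Definition cis (theta : R) : R[i] := cos theta +i* sin theta.

Lemma cis0 : cis 0 = 1.
Proof. by rewrite /cis cos0 sin0. Qed.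

Lemma cisD s t : cis (s + t) = cis s * cis t.
Proof. by apply/eqP; rewrite eq_complex/= cosD sinD eqxx addrC eqxx. Qed.

Lemma cisNK t : cis (- t) * cis t = 1.
Proof. by rewrite -cisD addNr cis0. Qed.

Lemma normc_cis t : normc (cis t) = 1.
Proof. by rewrite /normc /cis cos2Dsin2 sqrtr1. Qed.

Lemma conj_cis t : Num.conj (cis t) = cis (- t).
Proof. by rewrite /cis cosN sinN. Qed.

Variable d : nat.

Definition phase_rel : rel 'cV[R[i]]_d :=
  fun x x' => `[< exists theta : R, x = cis theta *: x' >].

Lemma phase_rel_refl : reflexive phase_rel.
Proof. by move=> x; apply/asboolP; exists 0; rewrite cis0 scale1r. Qed.

Lemma phase_rel_sym : symmetric phase_rel.
Proof.
suff H x y : phase_rel x y -> phase_rel y x by move=> x y; apply/idP/idP; exact: H.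
move=> /asboolP[t ->]; apply/asboolP; exists (- t).
by rewrite scalerA cisNK scale1r.
Qed.

Lemma phase_rel_trans : transitive phase_rel.
Proof.
move=> y x z /asboolP[s ->] /asboolP[t ->]; apply/asboolP; exists (s + t).
by rewrite scalerA cisD.
Qed.

Canonical phase_equiv : equiv_rel 'cV[R[i]]_d :=
  EquivRel phase_rel phase_rel_refl phase_rel_sym phase_rel_trans.

End Phase.

Definition phase_quot (R : realType) (d : nat) : Type :=
  {eq_quot (@phase_equiv R d)}.

HB.instance Definition _ (R : realType) (d : nat) :=
  Choice.on (phase_quot R d).
HB.instance Definition _ (R : realType) (d : nat) :=
  EqQuotient.on (phase_quot R d).

Section Measurements.
Context {R : realType}.

Definition inner (d : nat) (u v : 'cV[R[i]]_d) : R[i] :=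
  \sum_(n < d) u n 0 * Num.conj (v n 0).

(* In 0-based indices, n goes to (n + l) mod d; the default value n of insubd
   is never used, since the existence of n : 'I_d forces d > 0. *)
Definition shift_index (d : nat) (l : int) (n : 'I_d) : 'I_d :=
  insubd n `|((n%:Z + l) %% d%:Z)%Z|%N.

Definition shift (d : nat) (l : int) (x : 'cV[R[i]]_d) : 'cV[R[i]]_d :=
  \col_n x (shift_index l n) 0.

(* The column l : 'I_L carries the measurement of index l + 1, whose shift is
   (l + 1) a. *)
Definition vec_measurements (d K L a : nat) (m : 'I_K -> 'cV[R[i]]_d)
    (x : 'cV[R[i]]_d) : 'M[R]_(K, L) :=
  \matrix_(k, l) normc (inner (shift (l.+1 * a)%N%:Z (m k)) x) ^+ 2.

(* The singular values are the square roots of the eigenvalues, with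
   multiplicity, of the Hermitian matrix M^* M. *)
Definition singular_values (n : nat) (M : 'M[R[i]]_n) : seq R :=
  sort >=%R [seq Num.sqrt (complex.Re (spectral_diag (M^t* *m M) 0 k))
            | k <- enum 'I_n].

Definition nuclear_norm (n : nat) (M : 'M[R[i]]_n) : R :=
  \sum_(s <- singular_values M) s.

Definition outer (d : nat) (x : 'cV[R[i]]_d) : 'M[R[i]]_d := x *m x^t*.

Definition vec_annulus (d : nat) (p q : R) : set 'cV[R[i]]_d :=
  [set x | forall n, p <= normc (x n 0) <= q].

(* The notions above are invariant under a global phase, so that evaluating
   them at the representatives [repr] chosen by the quotient is harmless; see
   the lemmas at the end of the section. *)
Definition measurements (d K L a : nat) (m : 'I_K -> 'cV[R[i]]_d)
    (u : phase_quot R d) : 'M[R]_(K, L) :=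
  vec_measurements L a m (repr u).

Definition d1 (d : nat) (u v : phase_quot R d) : R :=
  nuclear_norm (outer (repr u) - outer (repr v)).

Definition annulus (d : nat) (p q : R) : set (phase_quot R d) :=
  [set u | vec_annulus p q (repr u)].

Definition mask_norm (d K : nat) (m : 'I_K -> 'cV[R[i]]_d) : R :=
  \big[Num.max/0]_(k < K) \big[Num.max/0]_(n < d) normc (m k n 0).

Definition euclid_norm (K L : nat) (M : 'M[R]_(K, L)) : R :=
  Num.sqrt (\sum_(k < K) \sum_(l < L) M k l ^+ 2).

Definition lipschitz_bound (d K L : nat) (D : set 'M[R]_(K, L))
    (A : 'M[R]_(K, L) -> phase_quot R d) (c : R) : Prop :=
  0 <= c /\
  forall u v, D u -> D v -> d1 (A u) (A v) <= c * euclid_norm (u - v).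

Definition lipschitz_constant (d K L : nat) (D : set 'M[R]_(K, L))
    (A : 'M[R]_(K, L) -> phase_quot R d) (c : R) : Prop :=
  lipschitz_bound D A c /\ forall c', lipschitz_bound D A c' -> c <= c'.

Lemma phase_quot_eqP (d : nat) (x y : 'cV[R[i]]_d) :
  \pi_(phase_quot R d) x = \pi_(phase_quot R d) y <->
  exists theta : R, x = cis theta *: y.
Proof.
split=> [/eqP|xy]; first by rewrite eqmodE => /asboolP.
by apply/eqP; rewrite eqmodE; apply/asboolP.
Qed.

Lemma repr_phase (d : nat) (x : 'cV[R[i]]_d) :
  exists theta : R, repr (\pi_(phase_quot R d) x) = cis theta *: x.
Proof. by apply/phase_quot_eqP; rewrite reprK. Qed.

Lemma outer_phase (d : nat) (t : R) (x : 'cV[R[i]]_d) :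
  outer (cis t *: x) = outer x.
Proof.
apply/matrixP => i j; rewrite !mxE !big_ord1 !mxE rmorphM/= mulrACA.
by rewrite [cis t * _]mulrC conj_cis cisNK mul1r.
Qed.

Lemma inner_phase (d : nat) (t : R) (u x : 'cV[R[i]]_d) :
  inner u (cis t *: x) = cis (- t) * inner u x.
Proof.
rewrite /inner big_distrr/=; apply: eq_bigr => n _.
by rewrite mxE rmorphM/= conj_cis mulrCA.
Qed.

Lemma measurements_pi (d K L a : nat) (m : 'I_K -> 'cV[R[i]]_d) x :
  measurements L a m (\pi x) = vec_measurements L a m x.
Proof.
apply/matrixP => k l; rewrite !mxE; have [t ->] := repr_phase x.
by rewrite inner_phase normcM normc_cis mul1r.
Qed.

Lemma d1_pi (d : nat) (x y : 'cV[R[i]]_d) :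
  d1 (\pi x) (\pi y) = nuclear_norm (outer x - outer y).
Proof.
by rewrite /d1; have [s ->] := repr_phase x; have [t ->] := repr_phase y;
  rewrite !outer_phase.
Qed.

Lemma annulus_pi (d : nat) (p q : R) (x : 'cV[R[i]]_d) :
  annulus p q (\pi x) <-> vec_annulus p q x.
Proof.
rewrite /annulus/=; have [t ->] := repr_phase x.
by split=> H n; have := H n; rewrite mxE normcM normc_cis mul1r.
Qed.

End Measurements.

(* Main.v *)
Require Import Defs.
From mathcomp Require Import zify ring lra.

(** The inverse [A] must separate two classes that the measurements barely
    distinguish.  Split the indices into an initial segment [0, h), with h about
    d / 4, and its complement.  Let y have entries q on the segment and 0
    elsewhere; let x have entries 0 on the segment, p on the delta indices of the
    complement nearest to each of its two (cyclic) ends, and q further inside.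
    The vectors x + y and x - y lie in the annulus and differ by a relative sign
    between two large blocks.

    They are far apart: the difference of their outer products is
    2 (x y^* + y x^* ), whose Frobenius norm, a lower bound of its nuclear norm
    ([frobenius_le_nuclear]), is sqrt 8 |x| |y| because x and y have disjoint
    supports ([nuclear_norm_outer_ge]).  As x and y each have a number of entries
    equal to q that is proportional to d, this is at least q^2 d / 2
    ([d1_block_ge]).

    Their measurements are close: a coordinate changes by
    |<w, x + y>|^2 - |<w, x - y>|^2 = 4 Re (<w, x> conj <w, y>), where w is a
    shifted mask, supported in a cyclic window of length delta.  The change is 0
    unless the window meets both blocks.  A window that meets both sees x only
    through entries p, so the change is then at most
    4 (delta |m| p) (delta |m| q) ([inner_block_buffered_le]).  The shifts
    advance by a, so at most 2 (delta / a + 1) <= 4 delta / a of them put the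
    window across one of the two block boundaries ([straddling_count]).
    Altogether the measurements differ by at most
    8 sqrt (K delta / a) delta^2 |m|^2 p q, and the quotient of the two estimates
    is the asserted bound with constant 1 / 16. *)

Set Implicit Arguments.
Unset Strict Implicit.

Import Order.TTheory GRing.Theory Num.Theory.
Import ComplexField.Normc.
Local Open Scope ring_scope.
Local Open Scope complex_scope.
Local Open Scope quotient_scope.
Local Open Scope sesquilinear_scope.

(** * Nuclear norm and Frobenius norm *)

Section Nuclear.
Variable R : realType.

Lemma sqr_normcE (z : R[i]) : normc z ^+ 2 = complex.Re z ^+ 2 + complex.Im z ^+ 2.
Proof. by case: z => a b /=; rewrite sqr_sqrtr // addr_ge0 ?sqr_ge0. Qed.

Lemma normc_nneg (z : R[i]) : 0 <= normc z.
Proof. by case: z => a b; apply: sqrtr_ge0. Qed.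

Lemma sum_spectral_diag (n : nat) (M : 'M[R[i]]_n) :
  M \is normalmx -> \sum_k spectral_diag M 0 k = \tr M.
Proof.
move=> /orthomx_spectralP {2}->.
by rewrite -mulmxA mxtrace_mulC -mulmxA mulmxV ?spectral_unit// mulmx1 mxtrace_diag.
Qed.

Lemma gram_normal (n : nat) (M : 'M[R[i]]_n) : M^t* *m M \is normalmx.
Proof.
apply/normalmxP; suff -> : (M^t* *m M)^t* = M^t* *m M by [].
rewrite trmx_mul map_mxM map_trmx trmxK; congr (_ *m _).
by apply/matrixP => i j; rewrite !mxE; exact: conjCK.
Qed.

(** [Num.sqrt] vanishes on negative numbers, so the [F i] may have any sign; in
    particular eigenvalues of a Gram matrix can be inserted without knowing
    that they are nonnegative. *)
Lemma sqrt_sum_le (I : finType) (F : I -> R) :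
  Num.sqrt (\sum_i F i) <= \sum_i Num.sqrt (F i).
Proof.
apply: (big_rec2 (fun x y => Num.sqrt x <= y)) => [|i x y _ xy]; first by rewrite sqrtr0.
have F0 := sqrtr_ge0 (F i); have x0 := sqrtr_ge0 x.
apply: (le_trans (y := Num.sqrt (F i) + Num.sqrt x)); last by rewrite lerD2l.
rewrite -[leRHS]ger0_norm ?addr_ge0// -sqrtr_sqr ler_sqrt ?sqr_ge0//.
have sq (t : R) : t <= Num.sqrt t ^+ 2.
  by case: (leP 0 t) => t0; [rewrite sqr_sqrtr | exact: le_trans (ltW t0) (sqr_ge0 _)].
have := sq (F i); have := sq x; nra.
Qed.

(** The squares of the singular values sum to the trace of the Gram matrix,
    which is the squared Frobenius norm; the l^1 norm of the singular values
    dominates their l^2 norm. *)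
Lemma frobenius_le_nuclear (n : nat) (M : 'M[R[i]]_n) :
  Num.sqrt (\sum_i \sum_j normc (M i j) ^+ 2) <= nuclear_norm M.
Proof.
rewrite /nuclear_norm /singular_values (perm_big _ (permEl (perm_sort _ _))) big_map.
rewrite big_enum /=; apply: le_trans _ (sqrt_sum_le _).
rewrite -raddf_sum sum_spectral_diag ?gram_normal// le_eqVlt; apply/orP; left.
apply/eqP; congr Num.sqrt; rewrite exchange_big /= raddf_sum.
apply: eq_bigr => j _; rewrite mxE raddf_sum; apply: eq_bigr => i _.
rewrite !mxE sqr_normcE; case: (M i j) => a b /=; ring.
Qed.

End Nuclear.

(** * Windows and shifts *)

Lemma sum_ord_interval d lo hi :
  (\sum_(n < d) (lo <= n < hi) = minn d hi - lo)%N.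
Proof.
elim: d => [|d IH]; first by rewrite big_ord0 min0n.
by rewrite big_ord_recr /= IH; case: (leqP lo d); case: (ltnP d hi) => /=; lia.
Qed.

(** The window of the shift t consists of the k < d such that (k + t) mod d <
    delta, a cyclic interval of length delta.  If it meets both [0, h) and
    [h, d), then it crosses the boundary at 0 or the one at h, which confines
    both t and the points of the window beyond h. *)
Lemma straddling_window (d h delta t n n' : nat) :
  (n < h)%N -> (h <= n')%N -> (n' < d)%N -> (t <= d)%N -> (delta <= h)%N ->
  ((n + t) %% d < delta)%N -> ((n' + t) %% d < delta)%N ->
  ((t < delta) || (d - h < t < d - h + delta))%N /\
  ((n' < h + delta) || (d - delta <= n'))%N.
Proof.
move=> nh hn' n'd td dh.
(* A sum of two numbers at most d wraps around at most once. *)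
have red k : (k < d)%N -> ((k + t) %% d < delta)%N -> (k + t < delta)%N \/ (d <= k + t < d + delta)%N.
  move=> kd; case: (ltnP (k + t) d) => kt; first by rewrite modn_small//; lia.
  by rewrite -(subnKC kt) modnDl modn_small; lia.
move=> /red H /red G; have := H ltac:(lia); have := G ltac:(lia); lia.
Qed.

Lemma card_multiples_le (L a T delta : nat) : (0 < a)%N ->
  (#|[pred j : 'I_L | T < j.+1 * a < T + delta]| <= (delta %/ a).+1)%N.
Proof.
move=> a0; set S := [pred j | _].
rewrite cardE -(size_map val) -(size_iota (T %/ a) (delta %/ a).+1).
apply: uniq_leq_size; first by rewrite map_inj_uniq ?enum_uniq//; exact: val_inj.
(* These j are confined to T %/ a <= j <= T %/ a + delta %/ a. *)
move=> _ /mapP[j + ->]; rewrite mem_enum inE mem_iota => /andP[Tj jT].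
have h1 : (T %/ a <= j)%N by rewrite -ltnS ltn_divLR.
rewrite h1 /= addnS ltnS.
have : (j.+1 * a < (T %/ a + delta %/ a).+2 * a)%N.
  apply: leq_trans jT _; have := divn_eq T a; have := divn_eq delta a.
  have := ltn_pmod T a0; have := ltn_pmod delta a0; nia.
by rewrite ltn_mul2r a0 /= !ltnS.
Qed.

(** A column counts when its window may cross one of the two boundaries; the
    two alternatives describe crossing at 0 and at h. *)
Lemma straddling_count L a d h delta : (0 < a)%N ->
  (\sum_(l < L) ((l.+1 * a < delta) || (d - h < l.+1 * a < d - h + delta))
    <= 2 * (delta %/ a).+1)%N.
Proof.
move=> a0; rewrite mul2n -addnn.
apply: leq_trans (leq_add (card_multiples_le L 0 delta a0) (card_multiples_le L (d - h) delta a0)).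
rewrite -!sum1_card [X in (_ <= X + _)%N]big_mkcond [X in (_ <= _ + X)%N]big_mkcond -big_split.
apply: leq_sum => l _ /=; rewrite !inE muln_gt0 a0 /= add0n.
by case: (_ < delta)%N; case: (_ < _ < _)%N.
Qed.

(** The constants are those of h = d %/ 4: both the segment [0, h) and the part
    of its complement at distance delta or more from the ends keep a fixed
    proportion of the d indices. *)
Lemma quarter_bounds d delta : (1 < delta)%N -> (4 * delta <= d)%N ->
  [/\ delta <= d %/ 4, d %/ 4 <= d, d <= 8 * (d %/ 4)
    & d <= 4 * (d - delta - (d %/ 4 + delta))]%N.
Proof. by move=> delta1 delta_d; split; lia. Qed.

Lemma double_count_le a delta : (a <= delta)%N ->
  (2 * (delta %/ a).+1 * a <= 4 * delta)%N.
Proof. by move=> a_delta; have := leq_trunc_div delta a; lia. Qed.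

(** * Size of the measurements *)

Section Inner.
Variable R : realType.

Lemma normc_sum (I : finType) (F : I -> R[i]) :
  normc (\sum_i F i) <= \sum_i normc (F i).
Proof.
apply: (big_rec2 (fun z x => normc z <= x)) => [|i x z _ zx]; first by rewrite normc0.
by apply: le_trans (le_normcD _ _) _; rewrite lerD2l.
Qed.

Lemma normc_conj (z : R[i]) : normc (Num.conj z) = normc z.
Proof. by case: z => a b /=; rewrite sqrrN. Qed.

(** The left-hand side is 4 |Re (z conj w)|. *)
Lemma polarization_le (z w : R[i]) :
  `|normc (z + w) ^+ 2 - normc (z - w) ^+ 2| <= 4 * (normc z * normc w).
Proof.
rewrite !sqr_normcE; case: z w => [a b] [c e] /=.
have -> : (a + c) ^+ 2 + (b + e) ^+ 2 - ((a - c) ^+ 2 + (b - e) ^+ 2)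
  = 4 * (a * c + b * e) by ring.
rewrite normrM ger0_norm// ler_pM2l// -sqrtrM ?addr_ge0 ?sqr_ge0//.
rewrite -sqrtr_sqr ler_sqrt ?mulr_ge0 ?addr_ge0 ?sqr_ge0//.
have := sqr_ge0 (a * e - b * c); nra.
Qed.

Lemma innerD d (w x y : 'cV[R[i]]_d) : inner w (x + y) = inner w x + inner w y.
Proof.
by rewrite /inner -big_split; apply: eq_bigr => n _; rewrite mxE rmorphD mulrDr.
Qed.

Lemma innerN d (w x : 'cV[R[i]]_d) : inner w (- x) = - inner w x.
Proof.
by rewrite /inner -sumrN; apply: eq_bigr => n _; rewrite mxE rmorphN mulrN.
Qed.

Lemma shift_indexE d (t : nat) (n : 'I_d) : shift_index t%:Z n = ((n + t) %% d)%N :> nat.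
Proof.
have d0 : (0 < d)%N by apply: leq_ltn_trans (ltn_ord n).
by rewrite /shift_index val_insubd -PoszD modz_nat /= ltn_mod d0.
Qed.

Lemma shift_index_inj d (t : nat) : injective (@shift_index d t%:Z).
Proof.
move=> n n' /(congr1 val); rewrite /= !shift_indexE => /eqP.
by rewrite eqn_modDr !modn_small// => /eqP/val_inj.
Qed.

Lemma normc_le_mask_norm d K (m : 'I_K -> 'cV[R[i]]_d) k n : normc (m k n 0) <= mask_norm m.
Proof.
apply: le_trans (le_bigmax _ (fun k => \big[Num.max/0]_n normc (m k n 0)) k).
exact: (le_bigmax _ (fun n => normc (m k n 0))).
Qed.

(** At most delta terms of the inner product survive, each of size at most
    mu B. *)
Lemma inner_shift_le d (delta t : nat) (mu B : R) (w x : 'cV[R[i]]_d) :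
  (forall n : 'I_d, w n 0 != 0 -> (n < delta)%N) ->
  (forall n, normc (w n 0) <= mu) -> 0 <= mu -> 0 <= B ->
  (forall n : 'I_d, ((n + t) %% d < delta)%N -> normc (x n 0) <= B) ->
  normc (inner (shift t%:Z w) x) <= delta%:R * (mu * B).
Proof.
move=> w_supp w_mu mu0 B0 xB; apply: le_trans (normc_sum _) _.
apply: (le_trans (y := \sum_(n < d) (n < delta)%:R * (mu * B))); last first.
  rewrite -mulr_suml -natr_sum ler_wpM2r ?mulr_ge0// ler_nat.
  by rewrite (sum_ord_interval d 0) subn0 geq_minr.
rewrite [leRHS](reindex_inj (@shift_index_inj d t)); apply: ler_sum => n _.
rewrite mxE normcM normc_conj shift_indexE.
case: ltnP => [lt_delta|ge_delta].
  by rewrite mul1r ler_pM ?normc_nneg ?xB.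
rewrite mul0r; case: eqP (@w_supp (shift_index t%:Z n)) => [->|_ /(_ isT)].
  by rewrite normc0 mul0r.
by rewrite shift_indexE ltnNge ge_delta.
Qed.

End Inner.

(** * Two vectors with close measurements *)

Section Vectors.
Variable R : realType.

(** The difference has entries 2 (x_i conj y_j + y_i conj x_j).  Since x_i or
    y_i vanishes, the cross terms drop out of the Frobenius norm, which leaves
    the bound exactly. *)
Lemma nuclear_norm_outer_ge d (x y : 'cV[R[i]]_d) :
  (forall n, x n 0 = 0 \/ y n 0 = 0) ->
  Num.sqrt (8 * ((\sum_n normc (x n 0) ^+ 2) * \sum_n normc (y n 0) ^+ 2))
    <= nuclear_norm (outer (x + y) - outer (x - y)).
Proof.
move=> xy0; apply: le_trans _ (frobenius_le_nuclear _).
rewrite le_eqVlt; apply/orP; left; apply/eqP; congr Num.sqrt.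
have entry i j : normc ((outer (x + y) - outer (x - y)) i j) ^+ 2 =
    4 * (normc (x i 0) ^+ 2 * normc (y j 0) ^+ 2 + normc (y i 0) ^+ 2 * normc (x j 0) ^+ 2).
  rewrite !mxE !big_ord1 !mxE rmorphD rmorphB.
  have [x0|y0] := xy0 i; rewrite ?x0 ?y0 normc0 expr0n /= mul0r.
    have -> : (0 + y i 0) * (Num.conj (x j 0) + Num.conj (y j 0)) -
      (0 - y i 0) * (Num.conj (x j 0) - Num.conj (y j 0)) = y i 0 * Num.conj (x j 0) *+ 2 by ring.
    by rewrite normcMn normcM normc_conj; ring.
  have -> : (x i 0 + 0) * (Num.conj (x j 0) + Num.conj (y j 0)) -
      (x i 0 - 0) * (Num.conj (x j 0) - Num.conj (y j 0)) = x i 0 * Num.conj (y j 0) *+ 2 by ring.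
  by rewrite normcMn normcM normc_conj; ring.
have row i : \sum_j normc ((outer (x + y) - outer (x - y)) i j) ^+ 2 =
    4 * (normc (x i 0) ^+ 2 * (\sum_j normc (y j 0) ^+ 2)
         + normc (y i 0) ^+ 2 * \sum_j normc (x j 0) ^+ 2).
  by rewrite !mulr_sumr -big_split mulr_sumr; apply: eq_bigr => j _; rewrite entry.
rewrite [RHS](eq_bigr _ (fun i _ => row i)) -mulr_sumr big_split /= -!mulr_suml; ring.
Qed.

Definition block (d h : nat) (q : R) : 'cV[R[i]]_d :=
  \col_n (if (n < h)%N then q else 0)%:C.

(** The entries p form a buffer of width delta at both ends of the complement of
    [0, h), seen cyclically: no window meeting [0, h) reaches beyond it. *)
Definition buffered (d h delta : nat) (p q : R) : 'cV[R[i]]_d :=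
  \col_n (if (n < h)%N then 0
          else if (h + delta <= n < d - delta)%N then q else p)%:C.

Lemma normc_real (x : R) : 0 <= x -> normc x%:C = x.
Proof. by move=> x0; rewrite /= expr0n addr0 sqrtr_sqr ger0_norm. Qed.

(** When the window misses one of the two blocks, the corresponding inner product
    is 0.  When it meets both, the condition on t holds and the window sees only
    the entries p of the complementary block, which turns one factor q into p. *)
Lemma inner_block_buffered_le d h delta t (mu p q : R) (w : 'cV[R[i]]_d) :
  (forall n : 'I_d, w n 0 != 0 -> (n < delta)%N) ->
  (forall n, normc (w n 0) <= mu) -> 0 <= mu -> 0 <= p -> 0 <= q ->
  (t <= d)%N -> (delta <= h)%N ->
  normc (inner (shift t%:Z w) (buffered d h delta p q)) *
  normc (inner (shift t%:Z w) (block d h q)) <=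
  ((t < delta) || (d - h < t < d - h + delta))%N%:R *
    ((delta%:R * (mu * p)) * (delta%:R * (mu * q))).
Proof.
move=> w_supp w_mu mu0 p0 q0 td dh.
have bound0 (x : 'cV[R[i]]_d) : (forall n : 'I_d, ((n + t) %% d < delta)%N -> x n 0 = 0) ->
    normc (inner (shift t%:Z w) x) = 0.
  move=> x0; apply/eqP; rewrite eq_le normc_nneg andbT.
  have := inner_shift_le w_supp w_mu mu0 (lexx 0) (x := x) (t := t).
  by rewrite !mulr0; apply=> n /x0 ->; rewrite normc0.
have rhs0 : 0 <= ((t < delta) || (d - h < t < d - h + delta))%N%:R *
    ((delta%:R * (mu * p)) * (delta%:R * (mu * q))) by rewrite !mulr_ge0.
case: (pselect (exists n : 'I_d, (n < h)%N /\ ((n + t) %% d < delta)%N)); last first.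
  move=> no; rewrite [X in _ * X]bound0 ?mulr0// => n nt; rewrite mxE ifF//.
  by apply/negP => nh; apply: no; exists n.
move=> [n [nh nt]].
case: (pselect (exists n : 'I_d, (h <= n)%N /\ ((n + t) %% d < delta)%N)); last first.
  move=> no; rewrite [X in X * _]bound0 ?mul0r// => n' nt'; rewrite mxE ifT//.
  by rewrite ltnNge; apply/negP => nh'; apply: no; exists n'.
move=> [n' [nh' nt']].
have [-> _] := straddling_window nh nh' (ltn_ord _) td dh nt nt'; rewrite mul1r.
apply: ler_pM; rewrite ?normc_nneg//; apply: inner_shift_le => // k kt; rewrite mxE normc_real.
- case: ltnP => // hk; have [_ kP] := straddling_window nh hk (ltn_ord _) td dh nt kt.
  by case: ifP => //; lia.
- by case: ifP => //; case: ifP.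
- by case: ifP.
- by case: ifP.
Qed.

Lemma measurements_diff_le d K L a h delta (m : 'I_K -> 'cV[R[i]]_d) (p q : R) :
  (0 < a)%N -> d = (a * L)%N -> (delta <= h)%N -> 0 <= p -> 0 <= q ->
  (forall (k : 'I_K) (n : 'I_d), m k n 0 != 0 -> (n < delta)%N) ->
  euclid_norm (vec_measurements L a m (buffered d h delta p q + block d h q)
               - vec_measurements L a m (buffered d h delta p q - block d h q)) <=
  Num.sqrt (K%:R * (2 * (delta %/ a).+1)%:R) *
    (4 * ((delta%:R * (mask_norm m * p)) * (delta%:R * (mask_norm m * q)))).
Proof.
move=> a0 dE dh p0 q0 m_supp.
set x := buffered _ _ _ _ _; set y := block _ _ _.
set B := 4 * _.
have mu0 : 0 <= mask_norm m by exact: bigmax_ge_id.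
have B0 : 0 <= B by rewrite !mulr_ge0.
rewrite -[X in _ * X](ger0_norm B0) -sqrtr_sqr -sqrtrM ?mulr_ge0// ler_sqrt; last first.
  by rewrite !mulr_ge0 ?sqr_ge0.
apply: (le_trans (y := \sum_(k < K) \sum_(l < L)
    ((l.+1 * a < delta) || (d - h < l.+1 * a < d - h + delta))%N%:R * B ^+ 2)).
  apply: ler_sum => k _; apply: ler_sum => l _.
  have td : (l.+1 * a <= d)%N by rewrite dE mulnC leq_mul2l ltn_ord orbT.
  rewrite -real_normK ?num_real// !mxE innerD innerD innerN.
  set c := (_ || _).
  have -> : c%:R * B ^+ 2 = (c%:R * B) ^+ 2 by case: c; rewrite ?mul1r// !mul0r expr0n.
  rewrite lerXn2r ?nnegrE ?mulr_ge0//; apply: le_trans (polarization_le _ _) _.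
  rewrite /B [leRHS]mulrCA ler_pM2l// /x /y; apply: inner_block_buffered_le => //.
    exact: m_supp.
  by move=> n; exact: normc_le_mask_norm.
rewrite sumr_const card_ord -[leLHS]mulr_natl -mulrA ler_wpM2l// -mulr_suml ler_wpM2r ?sqr_ge0//.
by rewrite -natr_sum ler_nat straddling_count.
Qed.

(** Only the h entries q of the block and the d - 2 delta - h entries q of the
    buffered vector are kept in the Frobenius norm; their product is at least
    d^2 / 32. *)
Lemma d1_block_ge d h delta (p q : R) :
  (d <= 8 * h)%N -> (h <= d)%N -> (d <= 4 * (d - delta - (h + delta)))%N -> 0 <= p -> 0 <= q ->
  q ^+ 2 * d%:R / 2 <=
    nuclear_norm (outer (buffered d h delta p q + block d h q)
                  - outer (buffered d h delta p q - block d h q)).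
Proof.
move=> dh hd dd p0 q0; set x := buffered _ _ _ _ _; set y := block _ _ _.
apply: le_trans _ (nuclear_norm_outer_ge _); last first.
  by move=> n; rewrite !mxE; case: ifP => _; [left|right].
have yE : (h%:R * q ^+ 2 <= \sum_n normc (y n 0) ^+ 2).
  have -> : h = (\sum_(n < d) (0 <= n < h))%N by rewrite sum_ord_interval; lia.
  rewrite natr_sum mulr_suml; apply: ler_sum => n _; rewrite mxE.
  by case: ifP => _; rewrite normc_real ?mul1r// mul0r sqr_ge0.
have xE : ((d - delta - (h + delta))%:R * q ^+ 2 <= \sum_n normc (x n 0) ^+ 2).
  have -> : (d - delta - (h + delta) = \sum_(n < d) (h + delta <= n < d - delta))%N.
    by rewrite sum_ord_interval; lia.
  rewrite natr_sum mulr_suml; apply: ler_sum => n _; rewrite mxE.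
  case: (ltnP n h) => nh.
    by rewrite (_ : (_ <= _ < _)%N = false) ?mul0r ?sqr_ge0//; lia.
  by case: ifP => _; rewrite normc_real ?mul1r// mul0r sqr_ge0.
have lhs0 : 0 <= q ^+ 2 * d%:R / 2 by rewrite !mulr_ge0 ?sqr_ge0.
rewrite -[leLHS]ger0_norm// -sqrtr_sqr ler_sqrt; last first.
  by rewrite !mulr_ge0 ?sumr_ge0// => n _; rewrite sqr_ge0.
apply: (le_trans (y := 8 * (((d - delta - (h + delta))%:R * q ^+ 2) * (h%:R * q ^+ 2)))); last first.
  by rewrite ler_pM2l// ler_pM ?mulr_ge0 ?sqr_ge0.
have -> : (q ^+ 2 * d%:R / 2) ^+ 2 = (q ^+ 4 / 4) * (d * d)%:R :> R by rewrite natrM; field.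
set e := (d - delta - (h + delta))%N.
have -> : 8 * (e%:R * q ^+ 2 * (h%:R * q ^+ 2)) = (q ^+ 4 / 4) * (32 * e * h)%:R :> R.
  by rewrite !natrM; field.
rewrite ler_wpM2l ?mulr_ge0 ?exprn_ge0// ler_nat.
have := leq_mul dh dd; rewrite -/e; lia.
Qed.

(** The supports are disjoint, so the relative sign leaves the moduli unchanged and
    each of them is p or q. *)
Lemma block_annulus d h delta (p q : R) (z : 'cV[R[i]]_d) :
  0 <= p -> p <= q ->
  z = buffered d h delta p q + block d h q \/ z = buffered d h delta p q - block d h q ->
  vec_annulus p q z.
Proof.
set x := buffered _ _ _ _ _; set y := block _ _ _.
move=> p0 pq zE; rewrite /vec_annulus /= => n; have q0 := le_trans p0 pq.
have -> : normc (z n 0) = normc (x n 0) + normc (y n 0).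
  case: zE => ->; rewrite !mxE; case: (ltnP n h) => _.
  - by rewrite add0r normc0 add0r.
  - by rewrite addr0 normc0 addr0.
  - by rewrite sub0r normcN normc0 add0r.
  - by rewrite subr0 normc0 addr0.
rewrite !mxE; case: (ltnP n h) => _; first by rewrite normc0 add0r normc_real// pq lexx.
by rewrite normc0 addr0; case: ifP => _; rewrite normc_real// pq lexx.
Qed.

End Vectors.

(** * The lower Lipschitz bound *)

Unset Implicit Arguments.

Local Open Scope classical_set_scope.

Theorem theorem2 (R : realType) :
  exists C : R, 0 < C /\
  forall (d K L a delta : nat) (m : 'I_K -> 'cV[R[i]]_d) (p q : R)
         (D : set 'M[R]_(K, L)) (A : 'M[R]_(K, L) -> phase_quot R d) (CA : R),
    (0 < d)%N -> ~~ odd d ->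
    (0 < K)%N -> (0 < L)%N -> (0 < a)%N -> (0 < delta)%N ->
    delta%:R <= d%:R / 4 :> R -> d = (a * L)%N -> (1 <= a < delta)%N ->
    (forall (k : 'I_K) (n : 'I_d), m k n 0 != 0 -> (n < delta)%N) ->
    0 < p -> p <= q ->
    [set measurements L a m u | u in annulus p q] `<=` D ->
    lipschitz_constant D A CA ->
    (forall u : phase_quot R d, annulus p q u -> A (measurements L a m u) = u) ->
    CA >= C * ((q * d%:R * Num.sqrt a%:R) /
               (p * Num.sqrt K%:R * mask_norm m ^+ 2 * delta%:R `^ (5 / 2)))
    /\ C * ((q * d%:R * Num.sqrt a%:R) /
            (p * Num.sqrt K%:R * mask_norm m ^+ 2 * delta%:R `^ (5 / 2)))
       = C * ((q * d%:R `^ (3 / 2)) /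
              (p * Num.sqrt (K * L)%:R * mask_norm m ^+ 2 * delta%:R `^ (5 / 2))).
Proof.
exists (1 / 16); split; first by [].
move=> d K L a delta m p q D A CA d0 _ K0 L0 a0 delta0 delta_d dE /andP[_ a_delta].
move=> m_supp p0 pq YD [[CA0 A_lip] _] AY.
set mu := mask_norm m.
have mu0 : 0 <= mu by exact: bigmax_ge_id.
have q0 : 0 < q by exact: lt_le_trans pq.
set dR := delta%:R : R; set sd := Num.sqrt dR; set sa := Num.sqrt (a%:R : R).
set sK := Num.sqrt (K%:R : R); set sL := Num.sqrt (L%:R : R).
have dR0 : 0 < dR by rewrite ltr0n.
have sd0 : 0 < sd by rewrite sqrtr_gt0.
have sa0 : 0 < sa by rewrite sqrtr_gt0 ltr0n.
have sK0 : 0 < sK by rewrite sqrtr_gt0 ltr0n.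
have sL0 : 0 < sL by rewrite sqrtr_gt0 ltr0n.
have sd2 : sd ^+ 2 = dR by rewrite sqr_sqrtr// ltW.
have sa2 : sa ^+ 2 = a%:R by rewrite sqr_sqrtr.
have dR52 : dR `^ (5 / 2) = dR ^+ 2 * sd.
  rewrite (_ : 5 / 2 = 2%:R + 2^-1); last by field.
  rewrite powRD; last by rewrite (gt_eqF dR0) implybT.
  by rewrite powR_mulrn ?ltW// powR12_sqrt// ltW.
split; last first.
  have d32 : (d%:R : R) `^ (3 / 2) = d%:R * (sa * sL).
    rewrite (_ : 3 / 2 = 1%:R + 2^-1); last by field.
    rewrite powRD; last by rewrite pnatr_eq0 -lt0n d0 implybT.
    by rewrite powR_mulrn// expr1 powR12_sqrt// {2}dE natrM sqrtrM.
  rewrite d32 natrM sqrtrM// -/sK -/sL -/mu -/dR dR52.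
  have [->|muN0] := eqVneq mu 0; first by rewrite expr0n /= !mulr0 !mul0r !invr0 !mulr0.
  by field; rewrite -/dR muN0 !lt0r_neq0.
rewrite -/sK -/sa -/mu dR52.
(* For zero masks the quotient is 0, division by 0 giving 0. *)
move: mu0; rewrite le_eqVlt => /predU1P[<-|mu0].
  by rewrite expr0n /= mulr0 mul0r invr0 !mulr0.
have delta_d4 : (4 * delta <= d)%N.
  by rewrite -(ler_nat R) natrM; move: delta_d; lra.
have [] := quarter_bounds (leq_ltn_trans a0 a_delta) delta_d4.
set h := (d %/ 4)%N => delta_h h_d d_h d_buffered.
set x := buffered d h delta p q; set y := block d h q.
have ann (z : 'cV[R[i]]_d) : z = x + y \/ z = x - y -> annulus p q (\pi_(phase_quot R d) z).
  by move=> zE; apply/annulus_pi; apply: block_annulus zE => //; exact: ltW.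
have inD z : annulus p q z -> D (measurements L a m z) by move=> zA; apply: YD; exists z.
have annx := ann (x + y) (or_introl erefl); have anny := ann (x - y) (or_intror erefl).
have := A_lip _ _ (inD _ annx) (inD _ anny).
rewrite !AY// !measurements_pi d1_pi => lip.
have low : q ^+ 2 * d%:R / 2 <= nuclear_norm (outer (x + y) - outer (x - y)).
  by apply: d1_block_ge; rewrite ?ltW.
have up := @measurements_diff_le R d K L a h delta m p q a0 dE delta_h (ltW p0) (ltW q0) m_supp.
rewrite -/x -/y /= -/mu -/dR in up.
(* delta %/ a + 1 <= 2 delta / a, since a < delta. *)
have cnt : Num.sqrt (K%:R * (2 * (delta %/ a).+1)%:R) <= 2 * (sK * (sd / sa)) :> R.
  rewrite sqrtrM// mulrCA ler_pM2l//.
  have N0 : 0 <= 2 * (sd / sa) by rewrite mulr_ge0// divr_ge0// ltW.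
  rewrite -[leRHS]ger0_norm// -sqrtr_sqr ler_sqrt ?sqr_ge0//.
  rewrite exprMn expr_div_n sd2 sa2 mulrA ler_pdivlMr ?ltr0n// -natrX -!natrM ler_nat.
  exact: double_count_le (ltnW a_delta).
have := le_trans low (le_trans lip (ler_wpM2l CA0 (le_trans up (ler_wpM2r _ cnt)))).
have P0 : 0 <= 4 * (dR * (mu * p) * (dR * (mu * q))) by rewrite !mulr_ge0// ltW.
move=> /(_ P0) key.
rewrite mulrA ler_pdivrMr; last by rewrite !mulr_gt0 ?exprn_gt0.
rewrite -(ler_pM2l (x := 8 * q / sa)); last by rewrite divr_gt0// mulr_gt0.
have -> : 8 * q / sa * (1 / 16 * (q * d%:R * sa)) = q ^+ 2 * d%:R / 2.
  by field; rewrite lt0r_neq0.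
by apply: le_trans key _; rewrite le_eqVlt; apply/orP; left; apply/eqP; field; rewrite lt0r_neq0.
Qed.
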